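(* Let $(M,g)$ be an $n$-dimensional space-time, $n\ge4$. Suppose we are given an affinely parametrised metric null geodesic $\gamma(s)$ with velocity vector $u^i$ and a solution $(b_j,q)$ along $\gamma(s)$ (a 1-form $b_j$ and a nowhere vanishing function $q$) of the system $$\nabla_ub_j=P_{ij}u^i+b_ku^kb_j-\tfrac12g_{ij}u^ig^{kl}b_kb_l,\qquad -q^{-1}\frac{dq}{ds}=\langle b,u\rangle .$$ Then $$\frac{d^2q}{ds^2}=-P(u,u)\,q .$$ Furthermore, in the orientation preserving reparametrisation $$\tau(s):=\int^sq^{-2}\,ds',$$ $\gamma(\tau)$ is a conformal geodesic with velocity $v^i=q^2u^i$ and 1-form $b_j$.
   Context: $g$ has signature $(1,n-1)$ and Levi-Civita connection $\nabla$; $\langle b,u\rangle=b_ku^k$; the Schouten tensor is $P_{ij}=\frac1{n-2}\left(R_{ij}-\frac{1}{2(n-1)}Rg_{ij}\right)$, where $(\nabla_i\nabla_j-\nabla_j\nabla_i)U^k=R_{ij}{}^k{}_lU^l$, $R_{jl}=R_{ij}{}^i{}_l$, $R=g^{jl}R_{jl}$, and $P(u,u)=P_{ij}u^iu^j$. Let $S_{ij}{}^{kl}=\delta_i^k\delta_j^l+\delta_i^l\delta_j^k-g_{ij}g^{kl}$. A conformal geodesic is a curve $\gamma(\tau)$ with (conformal) parameter $\tau$, velocity $v^i$, and a 1-form $b_j$ along it, satisfying $$\nabla_vv^k+b_lS_{ij}{}^{kl}v^iv^j=0,\qquad \nabla_vb_j-\tfrac12b_kb_lS_{ij}{}^{kl}v^i=P_{ij}v^i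 .$$ *)

(* Defs.v *)
From HB Require Import structures.
From mathcomp Require Import all_boot all_order all_algebra.
From mathcomp Require Import all_classical all_reals all_analysis.
Set Implicit Arguments.
Unset Strict Implicit.
Unset Printing Implicit Defensive.
Import Order.TTheory GRing.Theory Num.Theory.
Import numFieldNormedType.Exports.
Local Open Scope ring_scope.
Local Open Scope classical_set_scope.

(* Tangent vectors, 1-forms and tensors are represented by their components in
   the charts of an atlas; vectors and 1-forms are both row vectors.  With the
   library's Jacobian ['D_v f x = v *m 'J f x], the change of components under
   [f] is [u' = u *m 'J f x] for vectors, [b = b' *m ('J f x)^T] for 1-forms
   and [G = 'J f x *m G' *m ('J f x)^T] for covariant 2-tensors. *)

Section Calculus.
Context {R : realType} {n : nat}.

Definition partial (W : normedModType R) (i : 'I_n) (f : 'rV[R]_n -> W)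
    (x : 'rV[R]_n) : W :=
  'D_(delta_mx ord0 i) f x.

Fixpoint Ck_on (W : normedModType R) (k : nat) (U : set 'rV[R]_n)
    (f : 'rV[R]_n -> W) : Prop :=
  match k with
  | 0 => forall x, U x -> {for x, continuous f}
  | k'.+1 => (forall x, U x -> differentiable f x) /\
             (forall i, Ck_on k' U (partial i f))
  end.

Definition smooth_on (W : normedModType R) (U : set 'rV[R]_n)
    (f : 'rV[R]_n -> W) : Prop :=
  forall k, Ck_on k U f.

(* [\int_a^x f] with the usual sign when [x < a]. *)
Definition oriented_integral (f : R -> R) (a x : R) : R :=
  if a <= x then \int[@lebesgue_measure R]_(t in `[a, x]) f t
  else - \int[@lebesgue_measure R]_(t in `[x, a]) f t.

Definition open_interval (I : set R) : Prop := open I /\ is_interval I.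

(* [tau] is an orientation preserving reparametrisation of [I] onto the open
   interval [J], with inverse [sigma]. *)
Definition orientation_preserving_reparametrisation (I J : set R)
    (tau sigma : R -> R) : Prop :=
  [/\ open_interval J,
      tau @` I = J,
      forall s, I s -> derivable tau s 1 /\ 0 < derive1 tau s,
      forall t, J t -> derivable sigma t 1 /\ 0 < derive1 sigma t &
      forall s, I s -> sigma (tau s) = s].

End Calculus.

Section ChartGeometry.
Context {R : realType} {n : nat}.
Implicit Types (G : 'rV[R]_n -> 'M[R]_n) (U : 'I_n -> 'rV[R]_n -> R)
  (x : 'rV[R]_n) (i j k l m : 'I_n).

Definition ginv G x k l : R := invmx (G x) k l.

(* Gamma^k_{ij} *)
Definition christoffel G x i j k : R :=
  2^-1 * \sum_l ginv G x k l *
    (partial i (fun y => G y j l) x + partial j (fun y => G y i l) x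
     - partial l (fun y => G y i j) x).

(* nabla_j U^k *)
Definition nabla G U j k x : R :=
  partial j (U k) x + \sum_m christoffel G x j m k * U m x.

(* nabla_i nabla_j U^k *)
Definition nabla2 G U i j k x : R :=
  partial i (nabla G U j k) x
  - \sum_m christoffel G x i j m * nabla G U m k x
  + \sum_m christoffel G x i m k * nabla G U j m x.

(* The coefficients of [(nabla_i nabla_j - nabla_j nabla_i) U^k = R_ij^k_l U^l]
   are read off by taking for [U] the coordinate vector field of index [l]. *)
Definition coord_field l : 'I_n -> 'rV[R]_n -> R := fun k _ => (k == l)%:R.

(* R_ij^k_l *)
Definition riemann G i j k l x : R :=
  nabla2 G (coord_field l) i j k x - nabla2 G (coord_field l) j i k x.

Definition ricci G j l x : R := \sum_i riemann G i j i l x.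

Definition scalar_curvature G x : R :=
  \sum_j \sum_l ginv G x j l * ricci G j l x.

Definition schouten G i j x : R :=
  (n%:R - 2)^-1 *
  (ricci G i j x - (2 * (n%:R - 1))^-1 * scalar_curvature G x * G x i j).

(* S_ij^kl *)
Definition S_tensor G x i j k l : R :=
  (i == k)%:R * (j == l)%:R + (i == l)%:R * (j == k)%:R - G x i j * ginv G x k l.

Definition bilin (B : 'I_n -> 'I_n -> R) (u v : 'rV[R]_n) : R :=
  \sum_i \sum_j B i j * u ord0 i * v ord0 j.

Definition pairing (b u : 'rV[R]_n) : R := \sum_k b ord0 k * u ord0 k.

Definition lorentzian (A : 'M[R]_n) : Prop :=
  A^T = A /\
  exists2 E : 'M[R]_n, E \in unitmx &
    E *m A *m E^T = diag_mx (\row_(i < n) if i == 0%N :> nat then 1 else -1).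

End ChartGeometry.

(* The values of [cmap] outside [cdom] and of [cinv] outside the image of
   [cdom] are irrelevant. *)
Record local_chart (R : realType) (n : nat) (T : topologicalType) := LocalChart {
  cdom : set T;
  cmap : T -> 'rV[R]_n;
  cinv : 'rV[R]_n -> T;
  cdom_open : open cdom;
  cimg_open : open (cmap @` cdom);
  cmapK : forall p, cdom p -> cinv (cmap p) = p;
  cmap_continuous : forall p, cdom p -> {for p, continuous cmap};
  cinv_continuous : forall x, (cmap @` cdom) x -> {for x, continuous cinv}
}.

Definition transition (R : realType) (n : nat) (T : topologicalType)
    (c c' : local_chart R n T) : 'rV[R]_n -> 'rV[R]_n :=
  fun x => cmap c' (cinv c x).

Record manifold (R : realType) (n : nat) := Manifold {
  carrier :> topologicalType;
  atlas : Type;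
  chart : atlas -> local_chart R n carrier;
  manifold_hausdorff : hausdorff_space carrier;
  manifold_second_countable : @second_countable carrier;
  atlas_cover : forall p : carrier, exists a, cdom (chart a) p;
  atlas_smooth : forall a a',
    smooth_on (cmap (chart a) @` (cdom (chart a) `&` cdom (chart a')))
      (transition (chart a) (chart a'))
}.

Record spacetime (R : realType) (n : nat) := Spacetime {
  st_manifold :> manifold R n;
  metric : atlas st_manifold -> 'rV[R]_n -> 'M[R]_n;
  metric_smooth : forall a,
    smooth_on (cmap (chart a) @` cdom (chart a)) (metric a);
  metric_lorentzian : forall a x,
    (cmap (chart a) @` cdom (chart a)) x -> lorentzian (metric a x);
  metric_change : forall a a' (p : st_manifold),
    cdom (chart a) p -> cdom (chart a') p ->
    let x := cmap (chart a) p in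
    let J := 'J (transition (chart a) (chart a')) x in
    metric a x = J *m metric a' (cmap (chart a') p) *m J^T
}.

Section AlongCurves.
Context {R : realType} {n : nat} {M : spacetime R n}.
Implicit Types (I : set R) (gamma : R -> M) (a : atlas M) (s : R).

Definition coords gamma a s : 'rV[R]_n := cmap (chart a) (gamma s).

Definition velocity gamma a s : 'rV[R]_n := derive1 (coords gamma a) s.

Definition metric_at a gamma s i j : R := metric a (coords gamma a s) i j.

Definition ginv_at a gamma s k l : R := ginv (metric a) (coords gamma a s) k l.

Definition schouten_at a gamma s i j : R :=
  schouten (metric a) i j (coords gamma a s).

Definition christoffel_at a gamma s i j k : R :=
  christoffel (metric a) (coords gamma a s) i j k.

Definition S_at a gamma s i j k l : R :=
  S_tensor (metric a) (coords gamma a s) i j k l.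

(* Covariant derivatives along [gamma] of a vector field and of a 1-form along
   [gamma], given by their components in the chart [a]. *)
Definition cov_vector gamma a (V : R -> 'rV[R]_n) s k : R :=
  derive1 V s ord0 k
  + \sum_i \sum_j christoffel_at a gamma s i j k
                  * velocity gamma a s ord0 i * V s ord0 j.

Definition cov_form gamma a (b : R -> 'rV[R]_n) s j : R :=
  derive1 b s ord0 j
  - \sum_i \sum_k christoffel_at a gamma s i j k
                  * velocity gamma a s ord0 i * b s ord0 k.

(* The regularity under which the second order equations below make sense. *)
Definition curve_on I gamma : Prop :=
  open_interval I /\
  forall s, I s -> {for s, continuous gamma} /\
    forall a, cdom (chart a) (gamma s) ->
      derivable (coords gamma a) s 1 /\ derivable (velocity gamma a) s 1.

(* A differentiable 1-form along [gamma]; [b a s] is significant only when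
   [gamma s] is in the domain of the chart [a]. *)
Definition form_along I gamma (b : atlas M -> R -> 'rV[R]_n) : Prop :=
  (forall s a, I s -> cdom (chart a) (gamma s) -> derivable (b a) s 1) /\
  (forall s a a', I s -> cdom (chart a) (gamma s) -> cdom (chart a') (gamma s) ->
    b a s = b a' s *m
      ('J (transition (chart a) (chart a')) (coords gamma a s))^T).

Definition affine_null_geodesic I gamma : Prop :=
  curve_on I gamma /\
  forall s a, I s -> cdom (chart a) (gamma s) ->
    (forall k, cov_vector gamma a (velocity gamma a) s k = 0) /\
    bilin (metric_at a gamma s) (velocity gamma a s) (velocity gamma a s) = 0.

Definition conformal_geodesic I gamma (b : atlas M -> R -> 'rV[R]_n) : Prop :=
  [/\ curve_on I gamma,
      form_along I gamma b &
      forall s a, I s -> cdom (chart a) (gamma s) ->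
        let v := velocity gamma a in
        (forall k,
          cov_vector gamma a v s k
          + \sum_i \sum_j \sum_l b a s ord0 l * S_at a gamma s i j k l
                                 * v s ord0 i * v s ord0 j = 0) /\
        (forall j,
          cov_form gamma a (b a) s j
          - 2^-1 * \sum_i \sum_k \sum_l b a s ord0 k * b a s ord0 l
                                        * S_at a gamma s i j k l * v s ord0 i
          = \sum_i schouten_at a gamma s i j * v s ord0 i)].

End AlongCurves.

(* Main.v *)
(* By the Leibniz rule and the geodesic equation, the derivative of <b,u> along
   gamma is <nabla_u b, u> = P(u,u) + <b,u>^2, the remaining term vanishing since
   u is null; differentiating q' = - q <b,u> then gives q'' = - P(u,u) q.
   As tau' = q^-2 > 0, the inverse sigma of tau has derivative q^2, so that
   v = q^2 u.  Under this change of parameter the equation for b is multiplied by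
   q^2, and nabla_v v = 2 q^3 q' u = - 2 q^4 <b,u> u; the contraction
   b_l S_ij^kl v^i v^j = 2 <b,v> v^k - g(v,v) b^k cancels it because v is null. *)
Require Import Defs.
From HB Require Import structures.
From mathcomp Require Import all_boot all_order all_algebra.
From mathcomp Require Import all_classical all_reals all_analysis.
From mathcomp Require Import ring lra.
Import Order.TTheory GRing.Theory Num.Theory.
Import numFieldNormedType.Exports.
Local Open Scope ring_scope.
Local Open Scope classical_set_scope.

(** * Integrals and inverse functions on an open interval *)

Lemma open_interval_segment (R : realType) (I : set R) (x y : R) :
  open_interval I -> I x -> I y -> x <= y ->
  exists c d, [/\ c < x, y < d & `[c, d] `<=` I].
Proof.
move=> [oI iI] Ix Iy xy.
have nb z : I z -> exists2 e : R, 0 < e & forall w, `|z - w| < e -> I w.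
  by move=> Iz; have [e /= e0 h] : nbhs z I := open_nbhs_nbhs (conj oI Iz);
     exists e.
have [e e0 xeI] := nb x Ix; have [e' e'0 yeI] := nb y Iy.
have Hx : I (x - e / 2) by apply: xeI; rewrite opprB addrC subrK gtr0_norm; lra.
have Hy : I (y + e' / 2).
  by apply: yeI; rewrite opprD addrA subrr sub0r normrN gtr0_norm; lra.
exists (x - e / 2), (y + e' / 2); split; [lra|lra|].
move=> z /=; rewrite in_itv/= => /andP[cz zd].
by apply: (iI _ _ Hx Hy); rewrite cz zd.
Qed.

(** Near [s] the oriented integral is [F x - F a], where [F] integrates from a base point [c] to the
    left of both [a] and [x]. This covers both signs of [x - a], and the fundamental theorem of
    calculus applies to [F]. *)
Lemma is_derive_oriented_integral (R : realType) (I : set R) (f : R -> R)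
    (a s : R) :
  open_interval I -> (forall x, I x -> {for x, continuous f}) -> I a -> I s ->
  is_derive s 1 (oriented_integral f a) (f s).
Proof.
move=> hI cf Ia Is.
have [c [d [cm Md cdI]]] : exists c d,
    [/\ c < Num.min a s, Num.max a s < d & `[c, d] `<=` I].
  by have [as_|/ltW sa] := leP a s; exact: open_interval_segment.
have [ca cs] : c < a /\ c < s by move: cm; rewrite lt_min => /andP[].
have [ad sd] : a < d /\ s < d by move: Md; rewrite gt_max => /andP[].
have intf x y : c <= x -> y <= d ->
    (@lebesgue_measure R).-integrable `[x, y] (EFin \o f).
  move=> cx yd; apply: continuous_compact_integrable; first exact: segment_compact.
  apply: continuous_in_subspaceT => z; rewrite inE/= in_itv/= => /andP[xz zy].
  by apply/cf/cdI; rewrite /= in_itv/=; apply/andP; split; lra.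
pose F x := (\int[@lebesgue_measure R]_(t in `[c, x]) f t)%R.
have FB x y : c < x -> x <= y -> y <= d ->
    F y - F x = (\int[@lebesgue_measure R]_(t in `[x, y]) f t)%R.
  (* The difference of the two integrals is an integral over []x, y]]; adding the end point [x] does
     not change it. *)
  move=> cx xy yd; rewrite /F Rintegral_itvB ?bnd_simp//; [|exact: intf|exact: ltW].
  rewrite Rintegral_itv_obnd_cbnd//.
  apply: integrableS (intf _ _ (ltW cx) yd) => //.
  exact: subset_itv_oc_cc.
have [dF F'] : derivable F s 1 /\ F^`() s = f s.
  by apply: (continuous_FTC1_closed sd (intf _ _ (lexx _) (lexx _)) cs); exact: cf.
have hF : is_derive s 1 (fun x => F x - F a) (f s).
  have /derivableP DF := dF.
  apply: (@is_derive_eq _ _ _ (F - cst (F a)) s 1 _ _ (is_deriveB DF _)).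
  by rewrite subr0 -derive1E.
apply: near_eq_is_derive hF; near=> x.
have cx : c < x by near: x; exact: lt_nbhsr.
have xd : x < d by near: x; exact: lt_nbhsl.
rewrite /oriented_integral; case: ifPn => [ax|]; first by rewrite FB// ltW.
by rewrite -ltNge => xa; rewrite -FB ?opprB// ltW.
Unshelve. all: by end_near. Qed.

(** A positive derivative makes [tau] strictly increasing on [I], hence injective; the intermediate
    value theorem makes its image an interval, and the rule for inverse functions differentiates
    [sigma]. *)
Lemma reparametrisation_of_pos_derive (R : realType) (I : set R)
    (tau f : R -> R) :
  open_interval I -> (forall s, I s -> is_derive s 1 tau (f s)) ->
  (forall s, I s -> 0 < f s) ->
  exists J sigma,
    [/\ orientation_preserving_reparametrisation I J tau sigma,
        forall t, J t -> I (sigma t) &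
        forall t, J t -> is_derive t 1 sigma (f (sigma t))^-1].
Proof.
move=> hI dtau f0; have [oI iI] := hI.
have ctau s : I s -> {for s, continuous tau}.
  by move=> /dtau [dts _]; exact/differentiable_continuous/derivable1_diffP.
have inc x y : I x -> I y -> x < y -> tau x < tau y.
  move=> Ix Iy xy.
  have xyI z : x <= z <= y -> I z by move=> h; exact: (iI _ _ Ix Iy).
  apply: (@gtr0_derive1_incr _ tau x y) => //.
  - by move=> z; rewrite in_itv/= => /andP[? ?];
      have [] : is_derive z 1 tau (f z) by apply/dtau/xyI/andP; split; exact: ltW.
  - move=> z; rewrite in_itv/= => /andP[? ?].
    have Iz : I z by apply/xyI/andP; split; exact: ltW.
    by rewrite derive1E; have [_ ->] := dtau _ Iz; exact: f0.
  - apply: continuous_in_subspaceT => z; rewrite inE/= in_itv/= => h.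
    exact/ctau/xyI.
have inj x y : I x -> I y -> tau x = tau y -> x = y.
  move=> Ix Iy; case: (ltgtP x y) => // h; have := inc _ _ _ _ h.
    by move=> /(_ Ix Iy) + E; rewrite E ltxx.
  by move=> /(_ Iy Ix) + E; rewrite E ltxx.
pose J := tau @` I.
(* A chosen preimage, with default value 0 outside [J]; injectivity of [tau] on [I] makes it the
   inverse on [J]. *)
pose sigma t := xget 0 [set s | I s /\ tau s = t].
have sigP t : J t -> I (sigma t) /\ tau (sigma t) = t.
  move=> [s Is ts].
  by have := @xgetPex _ 0 [set s | I s /\ tau s = t]; apply; exists s.
have tauK s : I s -> sigma (tau s) = s.
  move=> Is; have [Iss e] : I (sigma (tau s)) /\ tau (sigma (tau s)) = tau s.
    by apply: sigP; exists s.
  exact: inj.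
have IVT' x y v : I x -> I y -> x <= y -> tau x <= v <= tau y ->
    exists2 z, x <= z <= y & tau z = v.
  move=> Ix Iy xy hv.
  have [||z] := @IVT _ tau x y v xy.
  - apply: continuous_in_subspaceT => z; rewrite inE/= in_itv/= => h.
    exact/ctau/(iI _ _ Ix Iy).
  - have h : tau x <= tau y by case/andP: hv; exact: le_trans.
    by rewrite min_l// max_r.
  - by rewrite in_itv/=; exists z.
have iJ : is_interval J.
  move=> _ _ [x Ix <-] [y Iy <-] v /andP[xv vy].
  have xy : x <= y.
    by rewrite leNgt; apply/negP => /(inc _ _ Iy Ix); rewrite ltNge (le_trans xv vy).
  have [z zxy <-] := IVT' x y v Ix Iy xy (introT andP (conj xv vy)).
  by exists z => //; exact: (iI _ _ Ix Iy).
(* Each [s] lies strictly between two points of [I], so [tau s] lies strictly between two points of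
   the interval [J]. *)
have oJ : open J.
  rewrite openE => _ [s Is <-]; rewrite /interior.
  have [c [d [cs sd cdI]]] := open_interval_segment R I s s hI Is Is (lexx _).
  have Ic : I c by apply: cdI; rewrite /= in_itv/= lexx/=; lra.
  have Id : I d by apply: cdI; rewrite /= in_itv/= lexx/= andbT; lra.
  have := inc _ _ Ic Is cs; have := inc _ _ Is Id sd => h1 h2.
  near=> t.
  apply: (iJ (tau c) (tau d)); [by exists c|by exists d|].
  apply/andP; split; apply/ltW; near: t; [exact: lt_nbhsr|exact: lt_nbhsl].
have dsig t : J t -> is_derive t 1 sigma (f (sigma t))^-1.
  (* Only the base point becomes [tau (sigma t)], the form in which the rule for inverse functions
     applies. *)
  move=> /sigP[Is ts]; rewrite -{1}ts.
  have nI : \forall x \near sigma t, I x by exact: open_nbhs_nbhs.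
  apply: is_derive_inverse.
  - by near=> x; apply: tauK; near: x.
  - by near=> x; apply: ctau; near: x.
  - exact: dtau.
  - by rewrite gt_eqF// f0.
exists J, sigma; split => //; last by move=> t /sigP[].
split => //.
- by move=> s Is; have [? e] := dtau _ Is; rewrite derive1E e; split=> //; exact: f0.
- move=> t Jt; have [? e] := dsig _ Jt; rewrite derive1E e; split=> //.
  by rewrite invr_gt0 f0//; have [] := sigP _ Jt.
Unshelve. all: by end_near. Qed.

(** * Derivatives of vector-valued functions, component by component *)

Lemma is_derive_mxP (R : realType) (V : normedModType R) (m n : nat)
    (A : V -> 'M[R]_(m, n)) (x v : V) (dA : 'M[R]_(m, n)) :
  is_derive x v A dA <-> forall i j, is_derive x v (fun y => A y i j) (dA i j).
Proof.
split=> [[dfA <-] i j|h].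
- split; first by move/derivable_mxP : dfA; exact.
  by rewrite derive_mx// mxE.
- have dfA : derivable A x v by apply/derivable_mxP => i j; case: (h i j).
  split=> //; rewrite derive_mx//; apply/matrixP => i j; rewrite mxE.
  by case: (h i j).
Qed.

Lemma is_derive_rV_comp (R : realType) (n : nat) (A : R -> 'rV[R]_n)
    (g : R -> R) (x dg : R) (dA : 'rV[R]_n) :
  is_derive (g x) 1 A dA -> is_derive x 1 g dg ->
  is_derive x 1 (A \o g) (dg *: dA).
Proof.
move=> /is_derive_mxP hA hg; apply/is_derive_mxP => i j; rewrite mxE mulrC.
by have := hA i j => {}hA; exact: (@is_derive1_comp _ (fun y => A y i j)).
Qed.

Lemma is_derive_scale_rV (R : realType) (n : nat) (k : R -> R)
    (A : R -> 'rV[R]_n) (x dk : R) (dA : 'rV[R]_n) :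
  is_derive x 1 k dk -> is_derive x 1 A dA ->
  is_derive x 1 (fun y => k y *: A y) (dk *: A x + k x *: dA).
Proof.
move=> hk /is_derive_mxP hA; apply/is_derive_mxP => i j; have {}hA := hA i j.
under eq_fun do rewrite mxE.
by apply: is_derive_eq; rewrite !mxE addrC; congr (_ + _); exact: mulrC.
Qed.

Lemma is_derive_pairing (R : realType) (n : nat) (b u : R -> 'rV[R]_n)
    (x : R) (db du : 'rV[R]_n) :
  is_derive x 1 b db -> is_derive x 1 u du ->
  is_derive x 1 (fun y => pairing (b y) (u y))
    (pairing db (u x) + pairing (b x) du).
Proof.
move=> /is_derive_mxP hb /is_derive_mxP hu.
have -> : (fun y => pairing (b y) (u y)) =
    \sum_(i < n) (fun y => b y ord0 i * u y ord0 i).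
  by apply/funext => y; rewrite fct_sumE.
have hbu i : is_derive x 1 (fun y => b y ord0 i * u y ord0 i)
    (db ord0 i * u x ord0 i + b x ord0 i * du ord0 i).
  have := hb ord0 i; have := hu ord0 i => hui hbi.
  by apply: is_derive_eq; rewrite addrC; congr (_ + _); exact: mulrC.
by apply: is_derive_eq; rewrite -big_split.
Qed.

(** * Contractions of the tensor S *)

Lemma sum_delta_l (R : realType) (n : nat) (k : 'I_n) (F : 'I_n -> R) :
  \sum_i (i == k)%:R * F i = F k.
Proof.
rewrite (bigD1 k)//= eqxx mul1r big1 ?addr0// => i /negPf ->.
by rewrite mul0r.
Qed.

(** Each Kronecker term of [S_tensor] contributes [pairing b v] times [v]; the metric term
    contributes the square of [v] times [b] with its index raised, which disappears for null [v]. *)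
Lemma S_tensor_contract_vectors (R : realType) (n : nat)
    (G : 'rV[R]_n -> 'M[R]_n) (x b v : 'rV[R]_n) (k : 'I_n) :
  \sum_i \sum_j \sum_l b ord0 l * S_tensor G x i j k l * v ord0 i * v ord0 j
  = 2 * pairing b v * v ord0 k
    - bilin (fun i j => G x i j) v v * \sum_l ginv G x k l * b ord0 l.
Proof.
have inner i j :
    \sum_l b ord0 l * S_tensor G x i j k l * v ord0 i * v ord0 j
    = (i == k)%:R * (v ord0 i * (b ord0 j * v ord0 j))
      + (j == k)%:R * (v ord0 j * (b ord0 i * v ord0 i))
      - G x i j * v ord0 i * v ord0 j * \sum_l ginv G x k l * b ord0 l.
  (* The terms already summed over [l] are expanded again into sums with a Kronecker delta, so that
     both sides can be compared summand by summand. *)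
  rewrite mulr_sumr -(sum_delta_l _ _ j
      (fun l => (i == k)%:R * (v ord0 i * (b ord0 l * v ord0 j)))).
  rewrite -(sum_delta_l _ _ i
      (fun l => (j == k)%:R * (v ord0 j * (b ord0 l * v ord0 i)))).
  rewrite -big_split/= -sumrB; apply: eq_bigr => l _.
  rewrite /S_tensor (eq_sym i l) (eq_sym j l).
  by ring.
under eq_bigr => i _ do under eq_bigr => j _ do rewrite inner.
under eq_bigr => i _ do
  rewrite sumrB big_split/= -mulr_sumr -mulr_sumr sum_delta_l -mulr_suml.
rewrite sumrB big_split/= sum_delta_l -mulr_sumr -mulr_suml.
by rewrite /bilin /pairing; ring.
Qed.

(** Half of this contraction is exactly the part of the given equation for [b] that is quadratic in
    [b]. *)
Lemma S_tensor_contract_forms (R : realType) (n : nat)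
    (G : 'rV[R]_n -> 'M[R]_n) (x b v : 'rV[R]_n) (j : 'I_n) :
  \sum_i \sum_k \sum_l b ord0 k * b ord0 l * S_tensor G x i j k l * v ord0 i
  = 2 * pairing b v * b ord0 j
    - (\sum_i G x i j * v ord0 i) * bilin (ginv G x) b b.
Proof.
have inner i :
    \sum_k \sum_l b ord0 k * b ord0 l * S_tensor G x i j k l * v ord0 i
    = 2 * (b ord0 i * v ord0 i) * b ord0 j
      - G x i j * v ord0 i * bilin (ginv G x) b b.
  have inner2 k : \sum_l b ord0 k * b ord0 l * S_tensor G x i j k l * v ord0 i
      = (k == i)%:R * (b ord0 k * b ord0 j * v ord0 i)
        + (k == j)%:R * (b ord0 k * b ord0 i * v ord0 i)
        - G x i j * v ord0 i * \sum_l ginv G x k l * b ord0 k * b ord0 l.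
    rewrite mulr_sumr -(sum_delta_l _ _ j
        (fun l => (k == i)%:R * (b ord0 k * b ord0 l * v ord0 i))).
    rewrite -(sum_delta_l _ _ i
        (fun l => (k == j)%:R * (b ord0 k * b ord0 l * v ord0 i))).
    rewrite -big_split/= -sumrB; apply: eq_bigr => l _.
    by rewrite /S_tensor (eq_sym i k) (eq_sym i l) (eq_sym j l) (eq_sym j k); ring.
  under eq_bigr => k _ do rewrite inner2.
  by rewrite sumrB big_split/= !sum_delta_l -mulr_sumr /bilin; ring.
under eq_bigr => i _ do rewrite inner.
by rewrite sumrB -mulr_suml -mulr_suml -mulr_sumr.
Qed.

(** * Covariant derivatives along a curve: product rule, rescaling, change of parameter *)

Section AlongCurve.
Context {R : realType} {n : nat} {M : spacetime R n}.
Implicit Types (gamma : R -> M) (a : atlas M) (b V : R -> 'rV[R]_n)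
  (f sigma : R -> R) (I : set R) (s t r : R).

Lemma is_derive1_derive1 (W : normedModType R) (f : R -> W) s :
  derivable f s 1 -> is_derive s 1 f (derive1 f s).
Proof. by move=> df; rewrite derive1E; exact: derivableP. Qed.

(** Component identities are differentiated in a fixed chart, so they must hold at nearby parameters
    too; openness of the chart domain and continuity of [gamma] ensure that the chart stays
    valid. *)
Lemma curve_on_near_chart I gamma a s :
  curve_on I gamma -> I s -> cdom (chart a) (gamma s) ->
  \forall x \near s, I x /\ cdom (chart a) (gamma x).
Proof.
move=> [[oI _] hg] Is as_.
have [cg _] := hg s Is.
apply: filterI; first exact: open_nbhs_nbhs.
by apply: cg; apply: open_nbhs_nbhs; split => //; exact: cdom_open.
Qed.

(* The connection terms cancel without symmetry of the Christoffel symbols. *)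
Lemma cov_Leibniz gamma a b V s :
  \sum_j cov_form gamma a b s j * V s ord0 j
    + \sum_k b s ord0 k * cov_vector gamma a V s k
  = pairing (derive1 b s) (V s) + pairing (b s) (derive1 V s).
Proof.
rewrite /cov_form /cov_vector /pairing.
under eq_bigr do rewrite mulrBl.
under [X in _ + X = _]eq_bigr do rewrite mulrDr.
rewrite sumrB big_split/= addrACA -[RHS]addr0; congr (_ + _).
rewrite addrC; apply/eqP; rewrite subr_eq0; apply/eqP.
under eq_bigr do rewrite mulr_sumr.
under [RHS]eq_bigr do rewrite mulr_suml.
rewrite exchange_big [RHS]exchange_big/=; apply: eq_bigr => i _.
under eq_bigr do rewrite mulr_sumr.
under [RHS]eq_bigr do rewrite mulr_suml.
rewrite exchange_big/=; apply: eq_bigr => j _; apply: eq_bigr => k _.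
by ring.
Qed.

Lemma cov_vector_near_eq gamma a V W s k :
  (\forall x \near s, V x = W x) ->
  cov_vector gamma a V s k = cov_vector gamma a W s k.
Proof.
move=> VW; rewrite /cov_vector !derive1E (near_eq_derive _ VW).
by rewrite (nbhs_singleton VW).
Qed.

Lemma cov_vector_scale gamma a f V s k :
  derivable f s 1 -> derivable V s 1 ->
  cov_vector gamma a (fun x => f x *: V x) s k
  = derive1 f s * V s ord0 k + f s * cov_vector gamma a V s k.
Proof.
move=> /is_derive1_derive1 df /is_derive1_derive1 dV.
rewrite /cov_vector [in LHS]derive1E.
have [_ ->] := is_derive_scale_rV _ _ _ _ _ _ _ df dV.
rewrite !mxE mulrDr -addrA; congr (_ + (_ + _)).
rewrite mulr_sumr; apply: eq_bigr => i _.
by rewrite mulr_sumr; apply: eq_bigr => j _; rewrite mxE; ring.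
Qed.

Lemma velocity_comp gamma sigma a t r :
  derivable (coords gamma a) (sigma t) 1 -> is_derive t 1 sigma r ->
  derivable (coords (gamma \o sigma) a) t 1 /\
  velocity (gamma \o sigma) a t = r *: velocity gamma a (sigma t).
Proof.
move=> /is_derive1_derive1 dg ds.
have [? e] := is_derive_rV_comp _ _ _ _ _ _ _ dg ds.
by split=> //; rewrite /velocity [LHS]derive1E.
Qed.

(** The derivative term gains the factor [r] by the chain rule, and the connection term gains it
    through the velocity. *)
Lemma cov_vector_comp gamma sigma a V t r k :
  derivable (coords gamma a) (sigma t) 1 -> is_derive t 1 sigma r ->
  derivable V (sigma t) 1 ->
  cov_vector (gamma \o sigma) a (V \o sigma) t k
  = r * cov_vector gamma a V (sigma t) k.
Proof.
move=> dg ds /is_derive1_derive1 dV.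
rewrite /cov_vector (velocity_comp _ _ _ _ _ dg ds).2 [in LHS]derive1E.
have [_ ->] := is_derive_rV_comp _ _ _ _ _ _ _ dV ds.
rewrite mxE mulrDr; congr (_ + _); rewrite mulr_sumr; apply: eq_bigr => i _.
rewrite mulr_sumr; apply: eq_bigr => j _; rewrite mxE /christoffel_at/=.
by rewrite /coords/=; ring.
Qed.

Lemma cov_form_comp gamma sigma a b t r j :
  derivable (coords gamma a) (sigma t) 1 -> is_derive t 1 sigma r ->
  derivable b (sigma t) 1 ->
  cov_form (gamma \o sigma) a (b \o sigma) t j
  = r * cov_form gamma a b (sigma t) j.
Proof.
move=> dg ds /is_derive1_derive1 db.
rewrite /cov_form (velocity_comp _ _ _ _ _ dg ds).2 [in LHS]derive1E.
have [_ ->] := is_derive_rV_comp _ _ _ _ _ _ _ db ds.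
rewrite mxE mulrBr; congr (_ - _); rewrite mulr_sumr; apply: eq_bigr => i _.
rewrite mulr_sumr; apply: eq_bigr => k _; rewrite mxE /christoffel_at/=.
by rewrite /coords/=; ring.
Qed.

End AlongCurve.

(** * The second order equation for [q] and the conformal parameter *)

Theorem proposition3p1 (R : realType) (n : nat) (hn : (4 <= n)%N)
    (M : spacetime R n) (I : set R) (gamma : R -> M)
    (b : atlas M -> R -> 'rV[R]_n) (q : R -> R)
    (hgamma : affine_null_geodesic I gamma)
    (hb : form_along I gamma b)
    (hq : forall s, I s -> derivable q s 1 /\ q s != 0)
    (hsys_b : forall s a, I s -> cdom (chart a) (gamma s) ->
      let u := velocity gamma a s in
      forall j,
        cov_form gamma a (b a) s j
        = \sum_i schouten_at a gamma s i j * u ord0 i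
          + pairing (b a s) u * b a s ord0 j
          - 2^-1 * (\sum_i metric_at a gamma s i j * u ord0 i)
                 * bilin (ginv_at a gamma s) (b a s) (b a s))
    (hsys_q : forall s a, I s -> cdom (chart a) (gamma s) ->
      - (q s)^-1 * derive1 q s = pairing (b a s) (velocity gamma a s)) :
  (forall s a, I s -> cdom (chart a) (gamma s) ->
    let u := velocity gamma a s in
    derivable (derive1 q) s 1 /\
    derive1n 2 q s = - bilin (schouten_at a gamma s) u u * q s) /\
  (forall s0 tau0, I s0 ->
    let tau := fun s => tau0 + oriented_integral (fun s' => (q s') ^- 2) s0 s in
    (forall s, I s -> is_derive s 1 tau ((q s) ^- 2)) /\
    exists J sigma,
      [/\ orientation_preserving_reparametrisation I J tau sigma,
          conformal_geodesic J (fun t => gamma (sigma t))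
            (fun a t => b a (sigma t)) &
          forall t a, J t -> cdom (chart a) (gamma (sigma t)) ->
            velocity (fun t' => gamma (sigma t')) a t
            = (q (sigma t)) ^+ 2 *: velocity gamma a (sigma t)]).
Proof.
have [hcurve hgeo] := hgamma; have [hI hreg] := hcurve; have [oI iI] := hI.
have hu s a : I s -> cdom (chart a) (gamma s) ->
    derivable (coords gamma a) s 1 /\ derivable (velocity gamma a) s 1.
  by move=> Is; have [_] := hreg _ Is; exact.
have hq' s a : I s -> cdom (chart a) (gamma s) ->
    derive1 q s = - (q s * pairing (b a s) (velocity gamma a s)).
  move=> Is as_; have [_ q0] := hq _ Is.
  by rewrite -hsys_q// mulrA mulrN divff// mulN1r opprK.
split.
  move=> s a Is as_ u.
  have [_ hdu] := hu _ _ Is as_; have hdb := hb.1 _ _ Is as_.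
  have [hdq q0] := hq _ Is.
  have := is_derive_pairing _ _ _ _ _ _ _
    (is_derive1_derive1 _ _ _ hdb) (is_derive1_derive1 _ _ _ hdu).
  (* Passing from coordinate to covariant derivatives lets the geodesic equation remove the terms
     containing the derivative of [u]. *)
  rewrite -(cov_Leibniz gamma a).
  rewrite [X in _ + X]big1; last first.
    by move=> k _; have [-> _] := hgeo _ _ Is as_; rewrite mulr0.
  rewrite addr0.
  have -> : \sum_j cov_form gamma a (b a) s j * velocity gamma a s ord0 j =
      bilin (schouten_at a gamma s) u u + pairing (b a s) u ^+ 2.
    under eq_bigr do rewrite hsys_b//.
    under eq_bigr do rewrite mulrBl mulrDl.
    rewrite sumrB big_split/=.
    (* Contracting the last term of the equation for [b] with [u] produces the factor g(u,u), which
       is zero. *)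
    have -> : \sum_(j < n) 2^-1 *
        (\sum_i metric_at a gamma s i j * velocity gamma a s ord0 i) *
        bilin (ginv_at a gamma s) (b a s) (b a s) * velocity gamma a s ord0 j
      = 2^-1 * bilin (metric_at a gamma s) u u
             * bilin (ginv_at a gamma s) (b a s) (b a s).
      move: (bilin (ginv_at a gamma s) (b a s) (b a s)) => B.
      rewrite /bilin exchange_big/= mulr_sumr mulr_suml.
      by apply: eq_bigr => j _; rewrite -mulr_suml; ring.
    have [_ ->] := hgeo _ _ Is as_; rewrite mulr0 mul0r subr0; congr (_ + _).
      rewrite /bilin exchange_big/=; apply: eq_bigr => j _.
      by rewrite mulr_suml.
    by rewrite expr2 {2}/pairing mulr_sumr; apply: eq_bigr => j _; rewrite mulrA.
  move=> hpair.
  (* The first order equation is needed on a neighbourhood of [s], within the one chart [a], before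
     it can be differentiated. *)
  have nq : \forall x \near s,
      - (q x * pairing (b a x) (velocity gamma a x)) = derive1 q x.
    have := curve_on_near_chart I gamma a s hcurve Is as_.
    by apply: filterS => x [Ix ax]; rewrite (hq' _ a).
  have hq2 : is_derive s 1 (derive1 q)
      (- bilin (schouten_at a gamma s) u u * q s).
    apply: near_eq_is_derive nq _.
    have := is_derive1_derive1 _ _ _ hdq; rewrite (hq' _ _ Is as_) => hdq'.
    have h := is_deriveN (is_deriveM hdq' hpair).
    apply: (@is_derive_eq _ _ _ _ _ _ _ _ h).
    (* The square of [pairing] coming from its own derivative cancels against the one coming from
       the derivative of [q]. *)
    by rewrite -/u /GRing.scale/=; ring.
  have [? e] := hq2; split=> //.
  by rewrite derive1Sn derive1n1 derive1E.
move=> s0 tau0 Is0 tau.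
have q2pos s : I s -> 0 < (q s) ^- 2.
  by move=> /hq[_ q0]; rewrite invr_gt0 exprn_even_gt0.
have dtau s : I s -> is_derive s 1 tau ((q s) ^- 2).
  move=> Is.
  (* The integrand is continuous because [q] is differentiable and has no zero. *)
  have cq2 x : I x -> {for x, continuous (fun y => (q y) ^- 2)}.
    move=> /hq[dq q0]; apply: cvgV; first by rewrite expf_neq0.
    have cq : {for x, continuous q}.
      exact/differentiable_continuous/derivable1_diffP.
    apply: (@continuous_comp _ _ _ q (fun y => y ^+ 2)) => //.
    exact: exprn_continuous.
  have h := is_derive_oriented_integral R I _ s0 s hI cq2 Is0 Is.
  have h' := is_deriveD (is_derive_cst tau0 s 1) h.
  by apply: (@is_derive_eq _ _ _ _ _ _ _ _ h'); rewrite add0r.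
split => //.
have [J [sigma [hrep sigI dsig']]] :=
  reparametrisation_of_pos_derive R I tau _ hI dtau q2pos.
have dsig t : J t -> is_derive t 1 sigma (q (sigma t) ^+ 2).
  by move=> Jt; have := dsig' t Jt; rewrite invrK.
have oJ : open J by have [[]] := hrep.
have velE t a : J t -> cdom (chart a) (gamma (sigma t)) ->
    velocity (gamma \o sigma) a t
    = (q (sigma t)) ^+ 2 *: velocity gamma a (sigma t).
  move=> Jt at_; have [dg _] := hu _ _ (sigI _ Jt) at_.
  exact: (velocity_comp _ _ _ _ _ dg (dsig _ Jt)).2.
have csig t : J t -> {for t, continuous sigma}.
  by move=> /dsig[? _]; exact/differentiable_continuous/derivable1_diffP.
(* The formula for the new velocity holds near [t], since [J] is open and the continuous [sigma]
   pulls back the neighbourhood on which the chart is valid. This permits differentiating it. *)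
have nearE t a : J t -> cdom (chart a) (gamma (sigma t)) ->
    \forall x \near t, ((fun y => q y ^+ 2 *: velocity gamma a y) \o sigma) x
                       = velocity (gamma \o sigma) a x.
  move=> Jt at_.
  have h1 := curve_on_near_chart I gamma a _ hcurve (sigI _ Jt) at_.
  have h2 : \forall x \near t, J x by exact: open_nbhs_nbhs.
  have h3 := csig _ Jt _ h1.
  near=> x; rewrite velE//; first by near: x.
  by apply: (proj2 (A := I (sigma x))); near: x.
have dq2 s : I s -> is_derive s 1 (fun y => q y ^+ 2) (2 * q s * derive1 q s).
  move=> Is; have hdq := is_derive1_derive1 _ _ _ (hq _ Is).1.
  apply: (@is_derive_eq _ _ _ _ _ _ _ _ (is_deriveM hdq hdq)).
  by rewrite /GRing.scale/=; ring.
have dq2u t a : J t -> cdom (chart a) (gamma (sigma t)) ->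
    derivable (fun y => q y ^+ 2 *: velocity gamma a y) (sigma t) 1.
  move=> Jt at_; have Is := sigI _ Jt.
  have du := is_derive1_derive1 _ _ _ (hu _ _ Is at_).2.
  by case: (is_derive_scale_rV _ _ _ _ _ _ _ (dq2 _ Is) du).
exists J, sigma; split=> //; split.
- split; first by have [] := hrep.
  move=> t Jt; split.
    apply: (@continuous_comp _ _ _ sigma gamma); first exact: csig.
    exact: (hreg _ (sigI _ Jt)).1.
  move=> a at_; split.
    exact: (velocity_comp _ _ _ _ _ (hu _ _ (sigI _ Jt) at_).1 (dsig _ Jt)).1.
  apply: near_eq_derivable (nearE _ _ Jt at_) _.
  have d2 := is_derive1_derive1 _ _ _ (dq2u _ _ Jt at_).
  by case: (is_derive_rV_comp _ _ _ _ _ _ _ d2 (dsig _ Jt)).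
(* The 1-form is composed with [sigma] without rescaling, so its chart transformation rule is the
   old one at [sigma t]. *)
- split.
    move=> t a Jt at_.
    have db := is_derive1_derive1 _ _ _ (hb.1 _ _ (sigI _ Jt) at_).
    by case: (is_derive_rV_comp _ _ _ _ _ _ _ db (dsig _ Jt)).
  by move=> t a a' Jt; exact: (hb.2 _ _ _ (sigI _ Jt)).
move=> t a Jt at_ v; have Is := sigI _ Jt.
have [dg du] := hu _ _ Is at_.
have db := hb.1 _ _ Is at_; have [geo null] := hgeo _ _ Is at_.
have vE : v t = q (sigma t) ^+ 2 *: velocity gamma a (sigma t) := velE _ _ Jt at_.
have pairZ (w : 'rV[R]_n) (c : R) : pairing (b a (sigma t)) (c *: w) =
    c * pairing (b a (sigma t)) w.
  by rewrite /pairing mulr_sumr; apply: eq_bigr => k _; rewrite mxE; ring.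
split=> k.
  rewrite (S_tensor_contract_vectors _ _ _ _ (b a (sigma t)) (v t)) vE pairZ.
  (* Nullity survives the rescaling: g(v,v) is [q ^+ 4] times g(u,u). *)
  rewrite [bilin _ _ _](_ : _ = 0); last first.
    rewrite -[RHS](mulr0 (q (sigma t) ^+ 4)) -null /bilin mulr_sumr.
    apply: eq_bigr => i _; rewrite mulr_sumr; apply: eq_bigr => j _.
    by rewrite !mxE /metric_at/=; ring.
  have nearE' : \forall x \near t, v x =
      ((fun y => q y ^+ 2 *: velocity gamma a y) \o sigma) x.
    by apply: filterS (nearE _ _ Jt at_) => x ->.
  rewrite (cov_vector_near_eq _ _ _ _ _ _ nearE').
  (* One factor [q ^+ 2] comes from the change of parameter; the rest is the covariant derivative of
     [q ^+ 2 *: u] along the original geodesic, where only the derivative of the scalar factor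
     survives. *)
  rewrite (cov_vector_comp _ _ _ _ _ _ _ dg (dsig _ Jt) (dq2u _ _ Jt at_)).
  have dq2' := dq2 _ Is; have [dq2d _] := dq2'.
  rewrite cov_vector_scale// geo derive1E derive_val (hq' _ a)// !mxE.
  by ring.
rewrite (S_tensor_contract_forms _ _ _ _ (b a (sigma t)) (v t)) vE pairZ.
(* Every term is now linear in the velocity and carries the factor [q ^+ 2]. The terms quadratic in
   [b] cancel against half of the contraction, leaving the Schouten term. *)
rewrite (cov_form_comp _ _ _ _ _ _ _ dg (dsig _ Jt) db) hsys_b//.
have sumZ (F : 'I_n -> R) : \sum_i F i * (q (sigma t) ^+ 2 *:
    velocity gamma a (sigma t)) ord0 i
    = q (sigma t) ^+ 2 * \sum_i F i * velocity gamma a (sigma t) ord0 i.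
  by rewrite mulr_sumr; apply: eq_bigr => i _; rewrite mxE; ring.
rewrite !sumZ.
rewrite /schouten_at /metric_at /ginv_at /coords/=.
by field.
Unshelve. all: by end_near. Qed.
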